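(* Let $n\in\mathbb N$ be fixed and let $\mathcal X,\mathcal Y$ be finite alphabets. The set $$S_{SE}(\text{solvable})=\{(A,W)\in \mathcal M_c^{n\times n}\times \mathcal{CH}_c(\mathcal X,\mathcal Y): C_0(W)>\eta(A)\}\subset \mathcal M_c^{n\times n}\times \mathcal{CH}_c(\mathcal X,\mathcal Y)$$ is not semi-decidable (for channels without feedback).
   Context: Computability. A sequence of rationals $(r_k)_{k\in\mathbb N}$ is computable if there are partial recursive functions $a,b,s:\mathbb N\to\mathbb N$ with $b(k)\neq 0$ and $r_k=(-1)^{s(k)}a(k)/b(k)$ for all $k\in\mathbb N$. A real $x$ is computable if there is a computable sequence of rationals $(r_k)$ with $|x-r_k|<2^{-k}$ for all $k$; $\mathbb R_c$ is the set of computable reals. A computable real is given as input to a Turing machine by a description (a program) of such a sequence; computable matrices and computable channels are given by descriptions of all their entries. A subset $M$ of a set $D$ of such objects is semi-decidable if there is a Turing machine (with the single output state ''stop'') that, for every input in $D$, stops if the input lies in $M$ and computes forever if it does not. Plants. $\mathcal M_c^{n\times n}$ is the set of $n\times n$ matrices $A$ with entries in $\mathbb R_c$ that describe an unstable system, i.e. have at least one eigenvalue $\lambda$ with $|\lambda|\ge 1$. With $\lambda_1(A),\dots,\lambda_n(A)$ the (complex) eigenvalues of $A$ repeated according to algebraic multiplicity, $\eta(A)=\sum_{j:|\lambda_j(A)|\ge 1}\log_2|\lambda_j(A)|$. Channels. $\mathcal{CH}_c(\mathcal X,\mathcal Y)$ is the set of computable channels, i.e. families $W=(W(y|x))_{x\in\mathcal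 X,y\in\mathcal Y}$ such that for each $x$, $W(\cdot|x)$ is a probability distribution on $\mathcal Y$ with all values in $\mathbb R_c$. For $x^m\in\mathcal X^m$, $y^m\in\mathcal Y^m$ let $W^m(y^m|x^m)=\prod_{j=1}^m W(y_j|x_j)$. Let $M(W,m)$ be the maximum cardinality of a set of mutually orthogonal vectors (vectors with pairwise disjoint supports) among the $W^m(\cdot|x^m)$ with $x^m\in\mathcal X^m$. The zero-error capacity is $C_0(W)=\liminf_{m\to\infty}\frac1m\log_2 M(W,m)$.
   Formalization: The theorem is stated for n ≥ 1 and alphabets X, Y with at least two letters each; for n = 0 or an alphabet with at most one letter the set is empty (no unstable plant, no channel, or C_0(W) ≤ 0 ≤ η(A)), hence semi-decidable, so the claim fails there. *)

(* Defs.v *)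
From Stdlib Require List.
From HB Require Import structures.
From mathcomp Require Import all_boot all_order all_algebra.
From mathcomp Require Import finmap complex.
From mathcomp Require Import all_classical all_reals all_analysis.

Set Implicit Arguments.
Unset Strict Implicit.
Unset Printing Implicit Defensive.

Import Order.TTheory GRing.Theory Num.Theory.

Local Open Scope classical_set_scope.
Local Open Scope ring_scope.

(* Kleene's schemes.  Arities are not recorded in the syntax: a program is run
   on a list of arguments, and has no value when the list does not fit. *)
Inductive recf : Type :=
| RZero
| RSucc
| RProj of nat
| RComp of recf & seq recf
| RRec of recf & recf
| RMu of recf.

(* [recf_eval p xs v]: the program p, run on the arguments xs, terminates with
   value v. *)
Inductive recf_eval : recf -> seq nat -> nat -> Prop :=
| EvalZero xs :
    recf_eval RZero xs 0
| EvalSucc x :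
    recf_eval RSucc [:: x] x.+1
| EvalProj i xs :
    (i < size xs)%N -> recf_eval (RProj i) xs (nth 0%N xs i)
| EvalComp f gs xs ys v :
    List.Forall2 (fun g y => recf_eval g xs y) gs ys -> recf_eval f ys v ->
    recf_eval (RComp f gs) xs v
| EvalRec0 f g xs v :
    recf_eval f xs v -> recf_eval (RRec f g) (0%N :: xs) v
| EvalRecS f g k xs y v :
    recf_eval (RRec f g) (k :: xs) y -> recf_eval g [:: k, y & xs] v ->
    recf_eval (RRec f g) (k.+1 :: xs) v
| EvalMu f xs k :
    (forall i, (i < k)%N -> exists y, recf_eval f (i :: xs) y.+1) ->
    recf_eval f (k :: xs) 0 ->
    recf_eval (RMu f) xs k.

(* Programs are presented to machines as binary words, in prefix notation; the
   code is prefix-free (see [enc_recf_prefix_free]), so concatenations of codes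
   are uniquely decodable. *)
Definition enc_nat (n : nat) : seq bool := rcons (nseq n true) false.

Fixpoint enc_recf (p : recf) : seq bool :=
  match p with
  | RZero => [:: false; false; false]
  | RSucc => [:: false; false; true]
  | RProj i => [:: false; true; false] ++ enc_nat i
  | RComp f gs =>
      [:: false; true; true] ++ enc_nat (size gs) ++ enc_recf f
        ++ flatten (map enc_recf gs)
  | RRec f g => [:: true; false; false] ++ enc_recf f ++ enc_recf g
  | RMu f => [:: true; false; true] ++ enc_recf f
  end.

Lemma enc_nat_prefix_free m n s t :
  enc_nat m ++ s = enc_nat n ++ t -> m = n /\ s = t.
Proof. by elim: m n => [|m IH] [|n] //= [] => [->|/IH[-> ->]]. Qed.

Lemma enc_recf_prefix_free p q s t :
  enc_recf p ++ s = enc_recf q ++ t -> p = q /\ s = t.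
Proof.
move: p q s t; fix IH 1 => p q s t.
case: p => [||i|f gs|f g|f]; case: q => [||j|f' gs'|f' g'|f'] //=.
- by case.
- by case.
- by case=> /enc_nat_prefix_free[-> ->].
- case; rewrite -!catA => /enc_nat_prefix_free[sz /IH[-> e]].
  suff [-> ->] : gs = gs' /\ s = t by [].
  elim: gs gs' sz e => [|g gs IHgs] [|g' gs'] //= [sz].
  by rewrite -!catA => /IH[-> /IHgs-/(_ sz)[-> ->]].
- by case; rewrite -!catA => /IH[-> /IH[-> ->]].
- by case=> /IH[-> ->].
Qed.

Inductive move := MoveLeft | MoveRight | Stay.

(* Deterministic machines with one two-way infinite tape.  A tape cell holds
   [None] (blank), an input bit [Some (inl b)], or an auxiliary symbol
   [Some (inr c)]. *)
Record turing_machine := TuringMachine {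
  tm_state : finType;
  tm_aux : finType;
  tm_start : tm_state;
  tm_stop : tm_state;
  tm_step : tm_state -> option (bool + tm_aux) ->
            tm_state * option (bool + tm_aux) * move
}.

(* The cells to the left of the head are listed from the head outwards;
   everything beyond either list is blank. *)
Record config (T : turing_machine) := Config {
  cfg_state : tm_state T;
  cfg_left : seq (option (bool + tm_aux T));
  cfg_head : option (bool + tm_aux T);
  cfg_right : seq (option (bool + tm_aux T))
}.

Definition tm_next (T : turing_machine) (c : config T) : config T :=
  let: Config q l h r := c in
  let: (q', h', d) := tm_step q h in
  match d with
  | MoveLeft => Config q' (behead l) (head None l) (h' :: r)
  | MoveRight => Config q' (h' :: l) (head None r) (behead r)
  | Stay => Config q' l h' r
  end.

Definition tm_init (T : turing_machine) (w : seq bool) : config T :=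
  let cells := [seq Some (inl b) | b <- w] in
  Config (tm_start T) [::] (head None cells) (behead cells).

Definition tm_halts (T : turing_machine) (w : seq bool) : Prop :=
  exists t : nat, cfg_state (iter t (@tm_next T) (tm_init T w)) = tm_stop T.

(* [describes w x]: the word w is a description of the object x. *)
Definition semi_decidable (U : Type) (describes : seq bool -> U -> Prop)
    (D M : set U) : Prop :=
  exists T : turing_machine, forall (x : U) (w : seq bool),
    D x -> describes w x ->
    (M x -> tm_halts T w) /\ (~ M x -> ~ tm_halts T w).

Record real_program := RealProgram {
  prog_num : recf;
  prog_den : recf;
  prog_sign : recf
}.

Definition computes_ratseq (d : real_program) (r : nat -> rat) : Prop :=
  forall k : nat, exists a b s : nat,
    [/\ recf_eval (prog_num d) [:: k] a,
        recf_eval (prog_den d) [:: k] b,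
        recf_eval (prog_sign d) [:: k] s,
        b <> 0%N
      & r k = (-1) ^+ s * (a%:R / b%:R)].

Definition describes_real (R : realType) (d : real_program) (x : R) : Prop :=
  exists2 r : nat -> rat, computes_ratseq d r
    & forall k : nat, `|x - ratr (r k)| < 2 ^- k.

Definition computable_real (R : realType) (x : R) : Prop :=
  exists d : real_program, describes_real d x.

Definition enc_real_program (d : real_program) : seq bool :=
  enc_recf (prog_num d) ++ enc_recf (prog_den d) ++ enc_recf (prog_sign d).

(* Matrix entries come first, in row-major order, then the channel entries. *)
Definition describes_pair (R : realType) (n : nat) (X Y : finType)
    (w : seq bool) (AW : 'M[R]_n * (X -> Y -> R)) : Prop :=
  exists (dA : 'I_n -> 'I_n -> real_program) (dW : X -> Y -> real_program),
    [/\ forall i j, describes_real (dA i j) (AW.1 i j),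
        forall x y, describes_real (dW x y) (AW.2 x y)
      & w = flatten [seq enc_real_program (dA i j) | i <- enum 'I_n, j <- enum 'I_n]
         ++ flatten [seq enc_real_program (dW x y) | x <- enum X, y <- enum Y]].

Definition log2 (R : realType) (x : R) : R := ln x / ln 2.

Definition mx_complex (R : realType) (n : nat) (A : 'M[R]_n) : 'M[R[i]]_n :=
  map_mx (real_complex R) A.

Definition cmodulus (R : realType) (z : R[i]) : R := complex.Re `|z|.

Definition eigenvalues (R : realType) (n : nat) (A : 'M[R]_n) : seq R[i] :=
  sval (closed_field_poly_normal (char_poly (mx_complex A))).

Definition unstable_plants (R : realType) (n : nat) : set 'M[R]_n :=
  [set A : 'M[R]_n | (forall i j, computable_real (A i j)) /\
           exists2 l : R[i], eigenvalue (mx_complex A) l & 1 <= cmodulus l].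
Arguments unstable_plants : clear implicits.

Definition eta (R : realType) (n : nat) (A : 'M[R]_n) : R :=
  \sum_(l <- eigenvalues A | 1 <= cmodulus l) log2 (cmodulus l).

Definition is_channel (R : realType) (X Y : finType) (W : X -> Y -> R) : Prop :=
  forall x, (forall y, 0 <= W x y) /\ \sum_(y : Y) W x y = 1.

Definition computable_channels (R : realType) (X Y : finType)
    : set (X -> Y -> R) :=
  [set W : X -> Y -> R | is_channel W /\ forall x y, computable_real (W x y)].
Arguments computable_channels : clear implicits.

Definition channel_pow (R : realType) (X Y : finType) (W : X -> Y -> R)
    (m : nat) (x : m.-tuple X) : {ffun m.-tuple Y -> R} :=
  [ffun y : m.-tuple Y => \prod_(j < m) W (tnth x j) (tnth y j)].

Definition orthogonal_vectors (R : realType) (I : finType)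
    (u v : {ffun I -> R}) : bool :=
  [disjoint [pred i | u i != 0] & [pred i | v i != 0]].

(* [V] ranges over the sets of vectors of the form W^m(.|x^m). *)
Definition max_orthogonal (R : realType) (X Y : finType) (W : X -> Y -> R)
    (m : nat) : nat :=
  \max_(V <- fpowerset [fset channel_pow W x | x in {: m.-tuple X}]%fset
        | pairwise (@orthogonal_vectors R _) (V : {fset _})) #|` V|.

(* The (irrelevant) term m = 0 of the sequence is 0. *)
Definition zero_error_capacity (R : realType) (X Y : finType)
    (W : X -> Y -> R) : \bar R :=
  limn_einf (fun m : nat => (m%:R^-1 * log2 (max_orthogonal W m)%:R)%:E).

Definition SE_solvable (R : realType) (n : nat) (X Y : finType)
    : set ('M[R]_n * (X -> Y -> R)) :=
  [set AW : 'M[R]_n * (X -> Y -> R) |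
     [/\ unstable_plants R n AW.1, computable_channels R X Y AW.2
       & ((eta AW.1)%:E < zero_error_capacity AW.2)%E]].
Arguments SE_solvable : clear implicits.

(* Main.v *)
Require Import Defs.
From mathcomp Require Import all_boot all_order all_algebra.
From mathcomp Require Import finmap complex.
From mathcomp Require Import all_classical all_reals all_analysis.
From mathcomp Require Import zify.

Set Implicit Arguments.
Unset Strict Implicit.
Unset Printing Implicit Defensive.

Import Order.TTheory GRing.Theory Num.Theory.

Local Open Scope classical_set_scope.

(** The zero-error capacity is a discontinuous function of the channel: a
    transition probability that is 0 may separate two inputs, and nobody can
    confirm in finite time that a computable real is 0.

    Take the identity as plant, so that [eta] is 0, and the channel
    [leaky_channel a]: one input [x0] always gives the output [y0], and all
    others give [y1] with probability [1 - a] and [y0] with probability [a].  If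
    [a = 0], then [x0] and any other input are never confused, and the capacity
    is at least 1 ([capacity_separated]).  If [a > 0], then every input may give
    [y0], no two input words can be told apart, and the capacity is 0
    ([capacity_confusable]).  So the pair is solvable if and only if [a = 0].

    Suppose that a machine [T] semi-decides solvability.  Choose [a] so as to
    contradict the answer of [T] on a description [w] of this very pair: [a] is
    [2 ^- t] if [T], run on [w], reaches its stop state first at time [t], and 0
    if it never does ([first_stop_limit]).  Then [T] stops on [w] iff [a > 0] iff
    the pair is not solvable, which is absurd.  The real [a] is computable
    because [2 ^- min t (k + 1)] approximates it up to [2 ^- k], for which [k + 1]
    steps of [T] have to be simulated.

    The circularity, [w] describing a channel whose entry [a] depends on [w], is
    resolved by Kleene's recursion theorem ([recursion_theorem]): a recursive
    function may use the source code of a program that computes it.  To apply it,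
    two things must be shown computable: the word [w] from the source code of a
    program for [a] ([computable_instance_word]), and the run of [T] on a given
    word ([computable_tm_next], [self_simulation]).  All this is done with
    primitive recursion on numbers, configurations and words being coded by
    iterated pairing. *)

(** * Computable functions *)

(** The inputs are functions on an arbitrary type [E], so that a program may be
    asked to work on codes of structured data only: the inputs [a e] need
    not range over all lists of numbers. *)
Definition computable (E : Type) (args : seq (E -> nat)) (f : E -> nat) : Prop :=
  exists p, forall e, recf_eval p [seq a e | a <- args] (f e).

Lemma computable_ext (E : Type) (args : seq (E -> nat)) (f g : E -> nat) :
  f =1 g -> computable args f -> computable args g.
Proof. by move=> fg [p pP]; exists p => e; rewrite -fg. Qed.

Lemma computable_input (E : Type) (args : seq (E -> nat)) (a : E -> nat) :
  List.In a args -> computable args a.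
Proof.
move=> aP; have [i [lti ai]] : exists i, (i < size args)%N /\
    forall e, nth 0%N [seq b e | b <- args] i = a e.
  elim: args aP => [//|b s IH] /= [->|/IH[i [lti ai]]]; first by exists 0%N.
  by exists i.+1.
by exists (RProj i) => e; rewrite -ai; apply: EvalProj; rewrite size_map.
Qed.

Lemma computable_comp (E F : Type) (args : seq (E -> nat))
    (args' : seq (F -> nat)) (h : E -> F) (f : F -> nat) :
  (forall a, List.In a args' -> computable args (fun e => a (h e))) ->
  computable args' f -> computable args (fun e => f (h e)).
Proof.
move=> args'P [p pP].
have [gs gsP] : exists gs, forall e, List.Forall2
    (fun g y => recf_eval g [seq a e | a <- args] y) gs [seq a (h e) | a <- args'].
  elim: args' args'P {pP} => [|a s IH] H; first by exists [::] => e; constructor.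
  have [g gP] := H a (or_introl erefl).
  have [gs gsP] := IH (fun b bs => H b (or_intror bs)).
  by exists (g :: gs) => e; constructor.
by exists (RComp p gs) => e; apply: EvalComp (gsP e) (pP _).
Qed.

Lemma computable_comp1 (E F : Type) (args : seq (E -> nat)) (c : F -> nat)
    (h : E -> F) (f : F -> nat) :
  computable [:: c] f -> computable args (fun e => c (h e)) ->
  computable args (fun e => f (h e)).
Proof. by move=> fP hP; apply: computable_comp fP => a [<-|[]]. Qed.

(** This carries a parameter of an iteration into its step, where [pre] is the
    current state and [h] forgets it. *)
Lemma computable_reindex (E F : Type) (h : E -> F) (pre : seq (E -> nat))
    (args : seq (F -> nat)) (f : F -> nat) :
  computable args f ->
  computable (pre ++ [seq (fun e => a (h e)) | a <- args]) (fun e => f (h e)).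
Proof.
apply: computable_comp => a aP; apply: computable_input.
apply/List.in_or_app; right; exact: (List.in_map (fun a e => a (h e)) _ _ aP).
Qed.

Lemma computable_const (E : Type) (args : seq (E -> nat)) (n : nat) :
  computable args (fun=> n).
Proof.
elim: n => [|n [p pP]]; first by exists RZero => e; constructor.
exists (RComp RSucc [:: p]) => e; apply: (@EvalComp _ _ _ [:: n]).
  by constructor; [exact: pP|constructor].
exact: EvalSucc.
Qed.

Lemma computable_succ (E : Type) (args : seq (E -> nat)) (f : E -> nat) :
  computable args f -> computable args (fun e => (f e).+1).
Proof.
apply: (@computable_comp1 _ _ _ id f succn).
by exists RSucc => e; apply: EvalSucc.
Qed.

(** The step may use the counter, the previous value, and the inputs of [e]; these
    are exactly the arguments that the primitive recursion scheme passes to it. *)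
Lemma computable_rec (E : Type) (args : seq (E -> nat)) (r : E -> nat -> nat)
    (f : E -> nat) :
  computable args (r^~ 0%N) ->
  computable [:: snd, (fun ek => r ek.1 ek.2)
               & [seq (fun ek => a ek.1) | a <- args]]
    (fun ek : E * nat => r ek.1 ek.2.+1) ->
  computable args f ->
  computable args (fun e => r e (f e)).
Proof.
move=> [b bP] [s sP] fP.
apply: (@computable_comp _ (E * nat) _ (snd :: [seq (fun ek => a ek.1) | a <- args])
  (fun e => (e, f e)) (fun ek => r ek.1 ek.2)).
  by move=> _ [<- //|/List.in_map_iff[a [<- aP]]]; exact: computable_input.
exists (RRec b s) => -[e k] /=.
have argsE y : [seq a (e, y) | a <- [seq (fun ek : E * nat => a ek.1) | a <- args]] =
    [seq a e | a <- args] by rewrite -map_comp.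
rewrite argsE; elim: k => [|k IH]; first exact/EvalRec0/bP.
by apply: EvalRecS IH _; move: (sP (e, k)); rewrite /= argsE.
Qed.

(** Data of any type [S] can be iterated on, as long as the step can be performed
    on their codes [c]; it need not make sense on numbers that are not codes. *)
Lemma computable_iter (E S : Type) (args : seq (E -> nat)) (c : S -> nat)
    (step : E -> S -> S) (s : E -> S) (f : E -> nat) :
  computable args f -> computable args (fun e => c (s e)) ->
  computable ((fun es => c es.2) :: [seq (fun es => a es.1) | a <- args])
    (fun es : E * S => c (step es.1 es.2)) ->
  computable args (fun e => c (iter (f e) (step e) (s e))).
Proof.
move=> fP sP stepP; apply: (@computable_rec _ _
  (fun e k => c (iter k (step e) (s e)))) => //=.
apply: (@computable_comp _ (E * S) _ _
  (fun ek => (ek.1, iter ek.2 (step ek.1) (s ek.1))) _ _ stepP) => a /=.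
move=> [<-|/List.in_map_iff[b [<- bP]]]; first by apply: computable_input; right; left.
apply: computable_input; right; right.
exact: (List.in_map (fun a (ek : E * nat) => a ek.1) _ _ bP).
Qed.

(** ** Arithmetic and case distinctions *)

Lemma computable_pred (E : Type) (args : seq (E -> nat)) (f : E -> nat) :
  computable args f -> computable args (fun e => (f e).-1).
Proof.
apply: (@computable_rec _ _ (fun _ k => k.-1)); first exact: computable_const.
by apply: computable_input; left.
Qed.

Lemma computable_add (E : Type) (args : seq (E -> nat)) (f g : E -> nat) :
  computable args f -> computable args g ->
  computable args (fun e => f e + g e)%N.
Proof.
move=> fP gP; apply: (@computable_ext _ _ (fun e => iter (g e) succn (f e))).
  by move=> e; rewrite iter_succn.
apply: (@computable_iter _ _ _ id (fun=> succn)) => //.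
by apply/computable_succ/computable_input; left.
Qed.

Lemma computable_sub (E : Type) (args : seq (E -> nat)) (f g : E -> nat) :
  computable args f -> computable args g ->
  computable args (fun e => f e - g e)%N.
Proof.
move=> fP gP; apply: (@computable_ext _ _ (fun e => iter (g e) predn (f e))).
  by move=> e; elim: (g e) => [|k IH]; rewrite ?subn0 // iterS IH subnS.
apply: (@computable_iter _ _ _ id (fun=> predn)) => //.
by apply/computable_pred/computable_input; left.
Qed.

Lemma computable_mul (E : Type) (args : seq (E -> nat)) (f g : E -> nat) :
  computable args f -> computable args g ->
  computable args (fun e => f e * g e)%N.
Proof.
move=> fP gP; apply: (@computable_ext _ _ (fun e => iter (g e) (addn (f e)) 0%N)).
  by move=> e; rewrite iter_addn_0.
apply: (@computable_iter _ _ _ id (fun e => addn (f e)) (fun=> 0%N)) => //.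
  exact: computable_const.
apply: computable_add; last by apply: computable_input; left.
exact: (computable_reindex fst [:: fun es => es.2] fP).
Qed.

Lemma computable_exp2 (E : Type) (args : seq (E -> nat)) (f : E -> nat) :
  computable args f -> computable args (fun e => 2 ^ f e)%N.
Proof.
move=> fP; apply: (@computable_ext _ _ (fun e => iter (f e) (muln 2) 1%N)).
  by move=> e; rewrite -iter_muln_1.
apply: (@computable_iter _ _ _ id (fun=> muln 2) (fun=> 1%N)) => //.
  exact: computable_const.
by apply: computable_mul; [exact: computable_const|apply: computable_input; left].
Qed.

Lemma computable_if (E : Type) (args : seq (E -> nat)) (b : E -> bool)
    (f g : E -> nat) :
  computable args (fun e => nat_of_bool (b e)) -> computable args f ->
  computable args g -> computable args (fun e => if b e then f e else g e).
Proof.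
move=> bP fP gP; apply: (@computable_ext _ _ (fun e => b e * f e + (1 - b e) * g e)%N).
  by move=> e; case: (b e); rewrite ?mul1n ?mul0n ?addn0.
by do !apply: computable_add || apply: computable_mul || apply: computable_sub
  || exact: computable_const || by [].
Qed.

Lemma computable_leq (E : Type) (args : seq (E -> nat)) (f g : E -> nat) :
  computable args f -> computable args g ->
  computable args (fun e => nat_of_bool (f e <= g e)%N).
Proof.
move=> fP gP; apply: (@computable_ext _ _ (fun e => 1 - (f e - g e))%N).
  by move=> e; rewrite -subn_eq0; case: (f e - g e)%N => [|k]; rewrite ?subSS ?sub0n.
by apply: computable_sub; [exact: computable_const|exact: computable_sub].
Qed.

(** Each entry of the table takes one case distinction, made by primitive recursion
    on the position. *)
Lemma computable_nth (E : Type) (args : seq (E -> nat)) (s : seq nat) (f : E -> nat) :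
  computable args f -> computable args (fun e => nth 0%N s (f e)).
Proof.
apply: (@computable_comp1 _ _ _ id).
elim: s => [|v s IH].
  apply: computable_ext (computable_const _ 0%N) => k; exact/esym/nth_nil.
apply: (@computable_rec _ _ (fun _ k => nth 0%N (v :: s) k)) => /=.
- exact: computable_const.
- by apply: computable_comp1 IH _; apply: computable_input; left.
- by apply: computable_input; left.
Qed.

(** On a finite type every function is computable, by looking up a table: this
    covers the transition function of a machine. *)
Lemma computable_finite (F : finType) (c g : F -> nat) :
  injective c -> computable [:: c] g.
Proof.
move=> c_inj; pose s := mkseq (fun k => if [pick x | c x == k] is Some x then g x
                                        else 0%N) (\max_x c x).+1.
apply: (@computable_ext _ _ (fun x => nth 0%N s (c x))) => [x|].
  rewrite nth_mkseq ?ltnS ?leq_bigmax //.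
  by case: pickP => [y /eqP/c_inj-> //|/(_ x)]; rewrite eqxx.
by apply: computable_nth; apply: computable_input; left.
Qed.

(** ** Pairs *)

(** As [a] is less than the gap [2 * (a + b) + 1] to the next square, [a + b] is
    the integer square root of [npair a b], which makes the projections easy to
    compute. *)
Definition npair (a b : nat) : nat := ((a + b) * (a + b) + a)%N.

(** The integer part of the square root. *)
Definition root (n : nat) : nat :=
  iter n (fun m => m + (m.+1 * m.+1 <= n))%N 0%N.

Definition nfst (n : nat) : nat := (n - root n * root n)%N.

Definition nsnd (n : nat) : nat := (root n - nfst n)%N.

Lemma root_npair a b : root (npair a b) = (a + b)%N.
Proof.
(* the iteration climbs by one until it reaches the root, and [n] is enough *)
have E k : iter k (fun m => m + (m.+1 * m.+1 <= npair a b))%N 0%N = minn k (a + b).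
  elim: k => [|k IH]; first by rewrite min0n.
  rewrite iterS IH /npair.
  have [ltk|lek] := ltnP k (a + b).
    have -> : (k.+1 * k.+1 <= (a + b) * (a + b) + a)%N.
      by rewrite (leq_trans (leq_mul ltk ltk)) ?leq_addr.
    by rewrite addn1; apply/esym/minn_idPl.
  have -> : ((a + b).+1 * (a + b).+1 <= (a + b) * (a + b) + a)%N = false.
    by apply/negbTE; rewrite -ltnNge; nia.
  by rewrite addn0; apply/esym/minn_idPr/ltnW.
by rewrite /root E; apply/minn_idPr; rewrite /npair; nia.
Qed.

Lemma nfst_npair a b : nfst (npair a b) = a.
Proof. by rewrite /nfst root_npair /npair addKn. Qed.

Lemma nsnd_npair a b : nsnd (npair a b) = b.
Proof. by rewrite /nsnd nfst_npair root_npair addKn. Qed.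

Lemma computable_npair (E : Type) (args : seq (E -> nat)) (f g : E -> nat) :
  computable args f -> computable args g ->
  computable args (fun e => npair (f e) (g e)).
Proof.
by move=> fP gP; do !apply: computable_add || apply: computable_mul || by [].
Qed.

Lemma computable_root (E : Type) (args : seq (E -> nat)) (f : E -> nat) :
  computable args f -> computable args (fun e => root (f e)).
Proof.
move=> fP; apply: (@computable_iter _ _ _ id
  (fun e m => m + (m.+1 * m.+1 <= f e))%N (fun=> 0%N)) => //.
  exact: computable_const.
have mP : computable ((fun es => es.2) :: [seq (fun es => a es.1) | a <- args])
    (fun es : E * nat => es.2) by apply: computable_input; left.
apply: computable_add => //; apply: computable_leq.
  by apply: computable_mul; exact: computable_succ.
exact: (computable_reindex fst [:: fun es => es.2] fP).
Qed.

Lemma computable_nfst (E : Type) (args : seq (E -> nat)) (f : E -> nat) :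
  computable args f -> computable args (fun e => nfst (f e)).
Proof.
move=> fP; apply: computable_sub => //.
by apply: computable_mul; exact: computable_root.
Qed.

Lemma computable_nsnd (E : Type) (args : seq (E -> nat)) (f : E -> nat) :
  computable args f -> computable args (fun e => nsnd (f e)).
Proof.
move=> fP; apply: computable_sub; first exact: computable_root.
exact: computable_nfst.
Qed.

(** * Words and programs as inputs *)

(** With [c] possibly 0, codes do not determine the length of a list; this is
    the right notion for a tape, which continues with blanks of code 0. *)
Definition list_code (T : Type) (c : T -> nat) (s : seq T) : nat :=
  foldr (fun x n => npair (c x) n) 0%N s.

Lemma nfst_list_code (T : Type) (c : T -> nat) (x0 : T) (s : seq T) :
  c x0 = 0%N -> nfst (list_code c s) = c (head x0 s).
Proof. by move=> cx0; case: s => [|x s] /=; rewrite ?nfst_npair. Qed.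

Lemma nsnd_list_code (T : Type) (c : T -> nat) (s : seq T) :
  nsnd (list_code c s) = list_code c (behead s).
Proof. by case: s => [|x s] //=; rewrite nsnd_npair. Qed.

(** The letters have nonzero codes, so that words are faithfully coded. *)
Definition word_code : seq bool -> nat := list_code (fun b : bool => b.+1).

Lemma size_word_code s : (size s <= word_code s)%N.
Proof.
elim: s => [//|b s IH] /=; rewrite -/(word_code s) /npair; move: IH.
move: (word_code s) => k; nia.
Qed.

Section Words.
Context {E : Type} {args : seq (E -> nat)}.
Implicit Types f g : E -> seq bool.

Definition catrev_step (az : seq bool * seq bool) : seq bool * seq bool :=
  if az.1 is b :: s then (s, b :: az.2) else az.

Lemma iter_catrev_step k a z :
  (size a <= k)%N -> iter k catrev_step (a, z) = ([::], catrev a z).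
Proof.
elim: k a z => [|k IH] [|b a] z //.
  by rewrite iterSr /= => _; rewrite IH.
by rewrite iterSr /= ltnS => /IH->.
Qed.

(** Letters are moved one by one from the first word to the second; the empty
    word is recognized by its code 0. *)
Lemma computable_catrev f g :
  computable args (fun e => word_code (f e)) ->
  computable args (fun e => word_code (g e)) ->
  computable args (fun e => word_code (catrev (f e) (g e))).
Proof.
move=> fP gP; pose c az := npair (word_code az.1) (word_code az.2).
(* the length of the word, needed as number of iterations, is not at hand, but
   its code is an upper bound, and the steps in excess change nothing *)
apply: (@computable_ext _ _
  (fun e => nsnd (c (iter (word_code (f e)) catrev_step (f e, g e))))) => [e|].
  by rewrite iter_catrev_step ?size_word_code // /c nsnd_npair.
apply: computable_nsnd; apply: (@computable_iter _ _ _ c (fun=> catrev_step)) => //.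
  exact: computable_npair.
apply: (@computable_comp1 _ _ _ c snd (fun az => c (catrev_step az))); last first.
  by apply: computable_input; left.
have cP : computable [:: c] c by apply: computable_input; left.
have aP := computable_nfst cP; have zP := computable_nsnd cP.
apply: (@computable_ext _ _ (fun az => if (nfst (c az) <= 0)%N then c az else
  npair (nsnd (nfst (c az))) (npair (nfst (nfst (c az))) (nsnd (c az))))).
  move=> [[|b a] z]; rewrite /c /= !nfst_npair //.
  by rewrite !nsnd_npair leqNgt (leq_trans _ (size_word_code (b :: a))).
apply: computable_if => //.
  by apply: computable_leq => //; exact: computable_const.
exact: computable_npair (computable_nsnd aP) (computable_npair (computable_nfst aP) zP).
Qed.

(** Concatenation is two reversals. *)
Lemma computable_cat f g :
  computable args (fun e => word_code (f e)) ->
  computable args (fun e => word_code (g e)) ->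
  computable args (fun e => word_code (f e ++ g e)).
Proof.
move=> fP gP; apply: (@computable_ext _ _
  (fun e => word_code (catrev (catrev (f e) [::]) (g e)))) => [e|].
  by rewrite !catrevE cats0 revK.
by do !apply: computable_catrev || exact: (computable_const _ 0) || by [].
Qed.

Lemma computable_flatten_allpairs (I J : Type) (s : seq I) (t : seq J)
    (f : E -> I -> J -> seq bool) :
  (forall i j, computable args (fun e => word_code (f e i j))) ->
  computable args (fun e => word_code (flatten [seq f e i j | i <- s, j <- t])).
Proof.
move=> fP; elim: s => [|i s IH]; first exact: (computable_const _ 0).
apply: (@computable_ext _ _ (fun e => word_code
    (flatten [seq f e i j | j <- t] ++ flatten [seq f e i j | i <- s, j <- t]))).
  by move=> e; rewrite allpairs_cons flatten_cat.
apply: computable_cat => //; elim: t {IH} => [|j t IH].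
  exact: (computable_const _ 0).
exact: computable_cat.
Qed.

End Words.

Definition source_code (p : recf) : nat := word_code (enc_recf p).

Lemma computable_source_comp1 (E : Type) (args : seq (E -> nat)) (f g : E -> recf) :
  computable args (fun e => source_code (f e)) ->
  computable args (fun e => source_code (g e)) ->
  computable args (fun e => source_code (RComp (f e) [:: g e])).
Proof.
move=> fP gP.
(* the prefix is the code of a composition with one inner program *)
apply: (@computable_ext _ _ (fun e => word_code
  ([:: false; true; true; true; false] ++ enc_recf (f e) ++ enc_recf (g e)))).
  by move=> e; rewrite /source_code /= cats0.
apply: computable_cat; first exact: computable_const.
exact: computable_cat.
Qed.

(** Unary numerals, whose source code is plainly computable from [n]. *)
Definition numeral (n : nat) : recf := iter n (fun p => RComp RSucc [:: p]) RZero.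

Lemma numeralP n xs : recf_eval (numeral n) xs n.
Proof.
elim: n => [|n IH]; first exact: EvalZero.
by apply: (EvalComp (ys := [:: n])); [repeat constructor|exact: EvalSucc].
Qed.

Lemma computable_source_numeral (E : Type) (args : seq (E -> nat)) (f : E -> nat) :
  computable args f -> computable args (fun e => source_code (numeral (f e))).
Proof.
move=> fP; apply: (@computable_iter _ _ _ source_code
  (fun=> fun p => RComp RSucc [:: p]) (fun=> RZero)) => //.
  exact: computable_const.
apply: computable_source_comp1; first exact: computable_const.
by apply: computable_input; left.
Qed.

(** Kleene's recursion theorem, by the usual diagonal argument.  Let [self p] be
    the program that runs [p] on the source code of [p].  As the source code of
    [self p] is computable from that of [p], some [q] computes [f (self p) k]
    from the source code of [p] and [k]; then [self q] is as required. *)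
Theorem recursion_theorem (f : recf -> nat -> nat) :
  computable [:: (fun pk => source_code pk.1); snd] (fun pk => f pk.1 pk.2) ->
  exists d, forall k, recf_eval d [:: k] (f d k).
Proof.
move=> fP; pose self p := RComp p [:: numeral (source_code p); RProj 0].
have selfP : computable [:: source_code] (fun p => source_code (self p)).
  (* the prefix is the code of a composition with two inner programs *)
  apply: (@computable_ext _ _ (fun p => word_code
    ([:: false; true; true; true; true; false] ++ enc_recf p ++
     enc_recf (numeral (source_code p)) ++ enc_recf (RProj 0)))) => [p //|].
  have srcP : computable [:: source_code] source_code by apply: computable_input; left.
  do !apply: computable_cat; rewrite -/source_code //; try exact: computable_const.
  exact: computable_source_numeral.
have [q qP] : computable [:: (fun pk => source_code pk.1); snd]
    (fun pk => f (self pk.1) pk.2).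
  apply: (@computable_comp _ (recf * nat) _ _ (fun pk => (self pk.1, pk.2)) _ _ fP).
  move=> a [<-|[<-|[]]] /=; last by apply: computable_input; right; left.
  apply: (@computable_comp1 _ _ _ source_code fst _ selfP).
  by apply: computable_input; left.
exists (self q) => k; apply: EvalComp (qP (q, k)).
constructor; first exact: numeralP.
by constructor; [apply: (@EvalProj 0 [:: k])|constructor].
Qed.

(** * Simulating a Turing machine *)

(** The blank must have code 0, and a bit the code that it has in [word_code]. *)
Definition symbol_code (A : countType) (h : option (bool + A)) : nat :=
  match h with
  | None => 0
  | Some (inl b) => b.+1
  | Some (inr a) => (choice.pickle a).+3
  end.

Lemma symbol_code_inj (A : countType) : injective (@symbol_code A).
Proof.
move=> [[[]|a]|] [[[]|a']|] //= [].
by move=> /(pcan_inj choice.pickleK)->.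
Qed.

Lemma tape_code_word (A : countType) (w : seq bool) :
  list_code (@symbol_code A) [seq Some (inl b) | b <- w] = word_code w.
Proof. by elim: w => [//|b w IH] /=; rewrite IH. Qed.

(** The part of a configuration on which the next step depends. *)
Definition local_code (T : turing_machine)
    (qh : tm_state T * option (bool + tm_aux T)) : nat :=
  npair (choice.pickle qh.1) (symbol_code qh.2).

Lemma local_code_inj (T : turing_machine) : injective (@local_code T).
Proof.
move=> [q h] [q' h'] E; congr pair.
  apply: (pcan_inj choice.pickleK); move: (congr1 nfst E).
  by rewrite /local_code !nfst_npair.
apply: symbol_code_inj; move: (congr1 nsnd E).
by rewrite /local_code !nsnd_npair.
Qed.

Definition config_code (T : turing_machine) (c : config T) : nat :=
  npair (local_code (cfg_state c, cfg_head c))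
    (npair (list_code (@symbol_code _) (cfg_left c))
           (list_code (@symbol_code _) (cfg_right c))).

(** A property of state and scanned symbol has finitely many cases. *)
Lemma computable_local (T : turing_machine)
    (g : tm_state T * option (bool + tm_aux T) -> nat) :
  computable [:: @config_code T] (fun c => g (cfg_state c, cfg_head c)).
Proof.
apply: (@computable_comp1 _ _ _ (@local_code T)
  (fun c : config T => (cfg_state c, cfg_head c))).
  exact/computable_finite/local_code_inj.
apply: (@computable_ext _ _ (fun c => nfst (config_code c))).
  by move=> c; rewrite /config_code nfst_npair.
by apply: computable_nfst; apply: computable_input; left.
Qed.

(** The new state, symbol and direction come from a table, and moving the head
    takes one symbol off one side of the tape and puts one on the other. *)
Lemma computable_tm_next (T : turing_machine) :
  computable [:: @config_code T] (fun c => config_code (tm_next c)).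
Proof.
pose next (c : config T) := tm_step (cfg_state c) (cfg_head c).
pose q' (c : config T) := choice.pickle (next c).1.1.
pose h' (c : config T) := symbol_code (next c).1.2.
pose isl (c : config T) := if (next c).2 is MoveLeft then true else false.
pose isr (c : config T) := if (next c).2 is MoveRight then true else false.
pose L (c : config T) := list_code (@symbol_code _) (cfg_left c).
pose R (c : config T) := list_code (@symbol_code _) (cfg_right c).
have q'P : computable [:: @config_code T] q'.
  exact: (computable_local (fun qh => choice.pickle (tm_step qh.1 qh.2).1.1)).
have h'P : computable [:: @config_code T] h'.
  exact: (computable_local (fun qh => symbol_code (tm_step qh.1 qh.2).1.2)).
have islP : computable [:: @config_code T] (fun c => nat_of_bool (isl c)).
  exact: (computable_local (fun qh => nat_of_bool
    (if (tm_step qh.1 qh.2).2 is MoveLeft then true else false))).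
have isrP : computable [:: @config_code T] (fun c => nat_of_bool (isr c)).
  exact: (computable_local (fun qh => nat_of_bool
    (if (tm_step qh.1 qh.2).2 is MoveRight then true else false))).
have cP : computable [:: @config_code T] (@config_code T).
  by apply: computable_input; left.
have LP : computable [:: @config_code T] L.
  apply: computable_ext (computable_nfst (computable_nsnd cP)) => c.
  by rewrite /config_code nsnd_npair nfst_npair.
have RP : computable [:: @config_code T] R.
  apply: computable_ext (computable_nsnd (computable_nsnd cP)) => c.
  by rewrite /config_code !nsnd_npair.
apply: (@computable_ext _ _ (fun c =>
  if isl c then npair (npair (q' c) (nfst (L c)))
                      (npair (nsnd (L c)) (npair (h' c) (R c)))
  else if isr c then npair (npair (q' c) (nfst (R c)))
                           (npair (npair (h' c) (L c)) (nsnd (R c)))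
  else npair (npair (q' c) (h' c)) (npair (L c) (R c)))) => [[q l h r]|].
  rewrite /isl /isr /q' /h' /L /R /next /=.
  case: (tm_step q h) => -[p s] [] /=; rewrite /config_code /local_code //=.
    by rewrite (@nfst_list_code _ _ None) // nsnd_list_code.
  by rewrite (@nfst_list_code _ _ None) // nsnd_list_code.
apply: computable_if => //; last (apply: computable_if => //).
- exact: computable_npair (computable_npair q'P (computable_nfst LP))
    (computable_npair (computable_nsnd LP) (computable_npair h'P RP)).
- exact: computable_npair (computable_npair q'P (computable_nfst RP))
    (computable_npair (computable_npair h'P LP) (computable_nsnd RP)).
- exact: computable_npair (computable_npair q'P h'P) (computable_npair LP RP).
Qed.

(** The least of [k] and the first [t] with [P t]: the iteration gets stuck at
    this [t]. *)
Definition first_stop (P : nat -> bool) (k : nat) : nat :=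
  iter k (fun t => t + ~~ P t)%N 0%N.

Lemma first_stop_never (P : nat -> bool) (k : nat) :
  (forall t, ~~ P t) -> first_stop P k = k.
Proof.
move=> NP; elim: k => [//|k IH].
by rewrite /first_stop iterS -/(first_stop P k) IH NP addn1.
Qed.

Lemma first_stop_min (P : nat -> bool) (t k : nat) :
  P t -> (forall s, P s -> t <= s)%N -> first_stop P k = minn k t.
Proof.
move=> Pt tmin; elim: k => [|k IH]; first by rewrite min0n.
rewrite /first_stop iterS -/(first_stop P k) IH.
have [ltk|lek] := ltnP k t; last by rewrite Pt addn0; apply/esym/minn_idPr/ltnW.
case: (boolP (P k)) => [/tmin|_]; first by rewrite leqNgt ltk.
by rewrite addn1; apply/esym/minn_idPl.
Qed.

Definition stopped_at (T : turing_machine) (w : seq bool) (t : nat) : bool :=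
  cfg_state (iter t (@tm_next T) (tm_init T w)) == tm_stop T.

(** By the recursion theorem, a program [d] can simulate the machine on any word
    that is computable from the source code of [d]. *)
Lemma self_simulation (T : turing_machine) (w : recf -> seq bool) :
  computable [:: source_code] (fun p => word_code (w p)) ->
  exists d, forall k,
    recf_eval d [:: k] (2 ^ first_stop (stopped_at T (w d)) k.+1)%N.
Proof.
move=> wP; apply: (recursion_theorem
  (f := fun p k => 2 ^ first_stop (stopped_at T (w p)) k.+1)%N).
have initP : computable [:: source_code] (fun p => config_code (tm_init T (w p))).
  apply: (@computable_ext _ _ (fun p => npair
    (npair (choice.pickle (tm_start T)) (nfst (word_code (w p))))
    (npair 0 (nsnd (word_code (w p)))))).
    move=> p; rewrite /config_code /local_code /= -(tape_code_word (tm_aux T)).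
    by rewrite (@nfst_list_code _ _ None) // nsnd_list_code.
  apply: computable_npair; apply: computable_npair; try exact: computable_const.
    exact: computable_nfst.
  exact: computable_nsnd.
have runP : computable [:: (fun pt : recf * nat => source_code pt.1); snd]
    (fun pt => config_code (iter pt.2 (@tm_next T) (tm_init T (w pt.1)))).
  apply: (@computable_iter _ _ _ _ (fun=> @tm_next T)).
  - by apply: computable_input; right; left.
  - apply: (@computable_comp1 _ _ _ source_code fst) initP _.
    by apply: computable_input; left.
  - apply: (@computable_comp1 _ _ _ _ snd) (computable_tm_next T) _.
    by apply: computable_input; left.
apply: computable_exp2; apply: (@computable_iter _ _ _ id
  (fun pk t => t + ~~ stopped_at T (w pk.1) t)%N (fun=> 0%N)).
- by apply: computable_succ; apply: computable_input; right; left.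
- exact: computable_const.
apply: computable_add; first by apply: computable_input; left.
apply: (@computable_comp1 _ _ _ (@config_code T) (fun pkt : recf * nat * nat =>
  iter pkt.2 (@tm_next T) (tm_init T (w pkt.1.1)))
  (fun c => nat_of_bool (cfg_state c != tm_stop T))).
  exact: (computable_local (fun qh => nat_of_bool (qh.1 != tm_stop T))).
apply: (@computable_comp _ (recf * nat) _ _ (fun pkt => (pkt.1.1, pkt.2)) _ _ runP).
by move=> a [<-|[<-|[]]]; apply: computable_input; [right; left|left].
Qed.

(** * A computable real that vanishes unless an event occurs *)

Local Open Scope ring_scope.

Lemma describes_quotient (R : realType) (num den : recf) (a b : nat -> nat) (x : R) :
  (forall k, recf_eval num [:: k] (a k)) -> (forall k, recf_eval den [:: k] (b k)) ->
  (forall k, b k <> 0%N) -> (forall k, `|x - (a k)%:R / (b k)%:R| < 2 ^- k) ->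
  describes_real (RealProgram num den RZero) x.
Proof.
move=> aP bP b0 xP; exists (fun k => (a k)%:R / (b k)%:R).
  move=> k; exists (a k), (b k), 0%N; split => //; first exact: EvalZero.
  by rewrite expr0 mul1r.
by move=> k; rewrite fmorph_div !rmorph_nat.
Qed.

Definition nat_program (n : nat) : real_program :=
  RealProgram (numeral n) (numeral 1) RZero.

Lemma describes_nat (R : realType) (n : nat) :
  describes_real (nat_program n) (n%:R : R).
Proof.
apply: (describes_quotient (a := fun=> n) (b := fun=> 1%N)) => // k.
- exact: numeralP.
- exact: numeralP.
- by rewrite divr1 subrr normr0 invr_gt0 exprn_gt0.
Qed.

Definition inverse_program (d : recf) : real_program :=
  RealProgram (numeral 1) d RZero.

Definition pred_program : recf := RRec RZero (RProj 0).

Lemma pred_programP k : recf_eval pred_program [:: k] k.-1.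
Proof.
elim: k => [|k IH]; first exact/EvalRec0/EvalZero.
exact: EvalRecS IH (@EvalProj 0 [:: k; k.-1] isT).
Qed.

(** When [d] computes [b k], the approximations are [(b k - 1) / b k], that is,
    1 minus those of [inverse_program d]. *)
Definition coinverse_program (d : recf) : real_program :=
  RealProgram (RComp pred_program [:: d]) d RZero.

Lemma describes_coinverse (R : realType) (d : recf) (b : nat -> nat) (x : R) :
  (forall k, recf_eval d [:: k] (b k)) -> (forall k, b k <> 0%N) ->
  (forall k, `|x - (b k)%:R^-1| < 2 ^- k) ->
  describes_real (inverse_program d) x /\ describes_real (coinverse_program d) (1 - x).
Proof.
move=> dP b0 xP; split.
  apply: (describes_quotient (a := fun=> 1%N) (b := b)) => // k.
    exact: numeralP.
  by rewrite mul1r.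
apply: (describes_quotient (a := fun k => (b k).-1) (b := b)) => // k.
  apply: (EvalComp (ys := [:: b k])); last exact: pred_programP.
  by constructor; [exact: dP|constructor].
have bk : (0 < b k)%N by rewrite lt0n; apply/eqP.
have bk0 : (b k)%:R != 0 :> R by rewrite pnatr_eq0 -lt0n.
rewrite -subn1 natrB // mulrBl divff // mul1r.
by rewrite opprB addrC addrA subrK distrC.
Qed.

(** The limit is [2 ^- t] for the first [t] with [P t], if any, and 0 otherwise.
    While [k < t], the approximation [2 ^- k.+1] exceeds the limit by at most
    itself, which is less than [2 ^- k]; afterwards it is exact. *)
Lemma first_stop_limit (R : realType) (P : nat -> bool) :
  exists x : R, [/\ 0 <= x <= 1, (exists t, P t) <-> 0 < x
    & forall k, `|x - (2 ^ first_stop P k.+1)%:R^-1| < 2 ^- k].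
Proof.
have lt2 k : 2 ^- k.+1 < 2 ^- k :> R.
  by rewrite ltf_pV2 ?posrE ?exprn_gt0 // ltr_eXn2l // ltr1n.
have [[t Pt]|NP] := pselect (exists t, P t).
  have exP : exists t, P t by exists t.
  case: (ex_minnP exP) => m Pm mmin; exists (2 ^- m); split.
  - rewrite invr_ge0 exprn_ge0 //= invf_le1 ?exprn_gt0 //.
    by rewrite exprn_ege1 // ler1n.
  - by split=> // _; rewrite invr_gt0 exprn_gt0.
  move=> k; rewrite (first_stop_min _ Pm) // natrX.
  have [lekm|ltmk] := leqP k.+1 m; last first.
    by rewrite subrr normr0 invr_gt0 exprn_gt0.
  have m0 : 0 < 2 ^- m :> R by rewrite invr_gt0 exprn_gt0.
  have le : 2 ^- m <= 2 ^- k.+1 :> R.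
    by rewrite lef_pV2 ?posrE ?exprn_gt0 // ler_eXn2l // ltr1n.
  rewrite distrC ger0_norm ?subr_ge0 //.
  by rewrite (lt_trans _ (lt2 k)) // ltrBlDr ltrDl.
exists 0; split; first by rewrite lexx ler01.
  by rewrite ltxx; split.
move=> k; rewrite first_stop_never.
  by rewrite natrX sub0r normrN ger0_norm ?invr_ge0 ?exprn_ge0.
by move=> t; apply/negP => Pt; apply: NP; exists t.
Qed.

(** * The identity plant *)

Lemma eigenvalue_identity (R : realType) (n : nat) (l : R[i]) :
  eigenvalue (mx_complex (1%:M : 'M[R]_n)) l -> l = 1.
Proof.
rewrite /mx_complex map_mx1 => /eigenvalueP[v]; rewrite mulmx1 => vl v0.
apply/eqP; rewrite -subr_eq0; apply: contraNT v0 => l0.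
have : (l - 1) *: v == 0 by rewrite scalerBl scale1r -vl subrr.
by rewrite scaler_eq0 (negPf l0).
Qed.

Lemma cmodulus1 (R : realType) : cmodulus (1 : R[i]) = 1.
Proof. by rewrite /cmodulus normr1. Qed.

(** The unknown list of eigenvalues need not be computed: 1 is the only possible
    one, and its logarithm is 0. *)
Lemma eta_identity (R : realType) (n : nat) : Defs.eta (1%:M : 'M[R]_n) = 0.
Proof.
rewrite /Defs.eta /eigenvalues; set p := char_poly _.
case: (closed_field_poly_normal p) => s /= sP.
rewrite big_seq_cond big1 // => l /andP[ls _].
rewrite (@eigenvalue_identity _ n l) ?cmodulus1 ?/log2 ?ln1 ?mul0r //.
rewrite eigenvalue_root_char -/p sP rootZ ?root_prod_XsubC //.
by rewrite lead_coef_eq0 monic_neq0 ?char_poly_monic.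
Qed.

Lemma unstable_identity (R : realType) (n : nat) :
  (0 < n)%N -> unstable_plants R n 1%:M.
Proof.
move=> n0; split.
  by move=> i j; rewrite mxE; exists (nat_program (i == j)); exact: describes_nat.
exists 1; last by rewrite cmodulus1.
rewrite /mx_complex map_mx1; apply/eigenvalueP.
exists (const_mx 1); first by rewrite mulmx1 scale1r.
apply/eqP => /rowP/(_ (Ordinal n0)); rewrite !mxE => /eqP.
by rewrite oner_eq0.
Qed.

(** * The zero-error capacity of a channel *)

(** If all inputs may give the output [y0], then all input words may give the
    output word made of [y0] only. *)
Lemma capacity_confusable (R : realType) (X Y : finType) (W : X -> Y -> R) (y0 : Y) :
  (forall x, W x y0 != 0) -> zero_error_capacity W = 0%E.
Proof.
move=> W0.
have M1 m : (max_orthogonal W m <= 1)%N.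
  apply/bigmax_leqP_seq => V; rewrite fpowersetE => /fsubsetP VP.
  have {}VP v : v \in enum_fset V -> v (nseq_tuple m y0) != 0.
    move=> /VP/imfsetP[x _ ->]; rewrite ffunE; apply/prodf_neq0 => j _.
    by rewrite tnth_nseq.
  case: (enum_fset V) VP => [|u [|v s]] //= VP.
  move=> /andP[/andP[/pred0P/(_ (nseq_tuple m y0)) /=]].
  by rewrite !inE !VP ?inE ?eqxx ?orbT.
(* the logarithm of 0 is 0 by convention, so the upper bound 1 is enough *)
have E : (fun m : nat => (m%:R^-1 * log2 (max_orthogonal W m)%:R)%:E) =
    cst (0 : \bar R)%E.
  apply/funext => m; case: (max_orthogonal W m) (M1 m) => [|[|k]] // _.
    by rewrite /log2 ln0 // mul0r mulr0.
  by rewrite /log2 ln1 mul0r mulr0.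
rewrite /zero_error_capacity E.
by case: (@cvg_limn_einf_sup R (cst 0%E) 0%E (cvg_cst _)).
Qed.

(** Words over two inputs that are never confused differ at some position, where
    their outputs show the difference. *)
Lemma max_orthogonal_separated (R : realType) (X Y : finType) (W : X -> Y -> R)
    (x0 x1 : X) (m : nat) :
  is_channel W -> (forall y, W x0 y * W x1 y = 0) ->
  (2 ^ m <= max_orthogonal W m)%N.
Proof.
move=> Wch W01; pose g (b : bool) := if b then x1 else x0.
pose word (b : m.-tuple bool) : m.-tuple X := map_tuple g b.
have Wn0 x : exists y, W x y != 0.
  apply/existsP; rewrite -[X in is_true X]negbK negb_exists; apply/negP => /forallP W0.
  have [_] := Wch x; rewrite big1 => [/esym/eqP|y _]; first by rewrite oner_eq0.
  by apply/eqP; rewrite -[_ == _]negbK.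
pose y x := projT1 (cid (Wn0 x)).
have yP x : W x (y x) != 0 by rewrite /y; case: cid.
have dis b b' : b != b' ->
    orthogonal_vectors (channel_pow W (word b)) (channel_pow W (word b')).
  move=> neq; have [j bj] : exists j, tnth b j != tnth b' j.
    apply/existsP; rewrite -[X in is_true X]negbK negb_exists; apply: contra neq.
    move=> /forallP bb'; apply/eqP/eq_from_tnth => j.
    by apply/eqP; rewrite -[_ == _]negbK.
  apply/pred0P => z; rewrite /= !inE !ffunE -negb_or; apply/negbTE; rewrite negbK.
  rewrite -mulf_eq0 -big_split /= (bigD1 j) //= !tnth_map mulf_eq0; apply/orP; left.
  case: (tnth b j) (tnth b' j) bj => [] [] //= _; last by rewrite W01.
  by rewrite mulrC W01.
have inj : injective (fun b => channel_pow W (word b)).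
  move=> b b' E; apply/eqP; apply/negPn/negP => /dis.
  rewrite -E => /pred0P/(_ [tuple y (tnth (word b) j) | j < m]).
  rewrite /= !inE andbb ffunE => /negbT/negP; apply; apply/prodf_neq0 => j _.
  by rewrite tnth_mktuple.
pose V := [fset channel_pow W (word b) | b in {: m.-tuple bool}]%fset.
have VE : #|` V| = (2 ^ m)%N.
  by rewrite card_imfset //= -cardE card_tuple card_bool.
rewrite -VE; apply: (@leq_bigmax_seq _ _ _ (fun V : {fset _} => #|` V|)).
  rewrite fpowersetE; apply/fsubsetP => _ /imfsetP[b _ ->].
  by apply/imfsetP; exists (word b).
pose v0 := channel_pow W (word [tuple false | _ < m]).
apply/(pairwiseP v0) => i j.
rewrite !inE => ilt jlt ij.
have /imfsetP[b _ Eb] := mem_nth v0 ilt.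
have /imfsetP[b' _ Eb'] := mem_nth v0 jlt.
rewrite Eb Eb'; apply: dis; apply: contraTN ij => /eqP bb'.
rewrite -leqNgt; apply/eq_leq/eqP.
by rewrite -(nth_uniq v0 jlt ilt) ?fset_uniq // Eb Eb' bb'.
Qed.

Lemma capacity_separated (R : realType) (X Y : finType) (W : X -> Y -> R)
    (x0 x1 : X) :
  is_channel W -> (forall y, W x0 y * W x1 y = 0) ->
  (1 <= zero_error_capacity W)%E.
Proof.
move=> Wch W01; rewrite /zero_error_capacity limn_einf_lim.
set u := (fun m : nat => _).
rewrite (cvg_lim _ (@cvg_einfs_sup R u)) //.
(* the term of index 0, where [m%:R^-1] is 0, has to be left out *)
apply: (le_trans _ (ereal_sup_ubound (x := einfs u 1) _)); last by exists 1%N.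
apply: le_ereal_inf_tmp => _ [m /= m1 <-]; rewrite lee_fin.
have m0 : 0 < m%:R :> R by rewrite ltr0n.
rewrite mulrC ler_pdivlMr // mul1r /log2.
have l2 : 0 < ln 2 :> R by rewrite ln_gt0 // ltr1n.
rewrite ler_pdivlMr // mulr_natl -lnXn // ler_ln ?posrE ?exprn_gt0 //.
  by rewrite -natrX ler_nat (max_orthogonal_separated _ Wch W01).
by rewrite ltr0n (leq_trans _ (max_orthogonal_separated m Wch W01)) // expn_gt0.
Qed.

(** * The reduction *)

Lemma computable_enc_real_program (E : Type) (args : seq (E -> nat))
    (d : E -> real_program) :
  computable args (fun e => source_code (prog_num (d e))) ->
  computable args (fun e => source_code (prog_den (d e))) ->
  computable args (fun e => source_code (prog_sign (d e))) ->
  computable args (fun e => word_code (enc_real_program (d e))).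
Proof. by move=> nP dP sP; do 2?apply: computable_cat. Qed.

Section Reduction.
Context {X Y : finType} (x0 : X) (y0 y1 : Y).

(** The inputs other than [x0] leak to the output [y0] of [x0]. *)
Definition leaky_channel (R : realType) (a : R) (x : X) (y : Y) : R :=
  if x == x0 then (y == y0)%:R
  else if y == y0 then a else if y == y1 then 1 - a else 0.

Definition leaky_program (d : recf) (x : X) (y : Y) : real_program :=
  if x == x0 then nat_program (y == y0)
  else if y == y0 then inverse_program d
  else if y == y1 then coinverse_program d else nat_program 0.

(** The description of the pair that consists of the identity and of the channel
    with leakage [a], when the inverses of the values of [d] converge to [a]. *)
Definition instance_word (n : nat) (d : recf) : seq bool :=
  flatten [seq enc_real_program (nat_program (i == j)) | i <- enum 'I_n, j <- enum 'I_n]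
  ++ flatten [seq enc_real_program (leaky_program d x y) | x <- enum X, y <- enum Y].

Lemma computable_instance_word (n : nat) :
  computable [:: source_code] (fun d => word_code (instance_word n d)).
Proof.
have dP : computable [:: source_code] source_code by apply: computable_input; left.
apply: computable_cat; first exact: computable_const.
apply: (computable_flatten_allpairs _ _
  (f := fun d x y => enc_real_program (leaky_program d x y))) => x y.
have zeroP := computable_const [:: source_code] (source_code RZero).
rewrite /leaky_program; case: (x == x0); first exact: computable_const.
case: (y == y0).
  apply: (computable_enc_real_program (d := inverse_program)) => //.
  exact: (computable_const _ (source_code (numeral 1))).
case: (y == y1); last exact: computable_const.
apply: (computable_enc_real_program (d := coinverse_program)) => //.
exact: computable_source_comp1 (computable_const _ (source_code pred_program)) dP.
Qed.

Lemma instance_word_describes (R : realType) (n : nat) (d : recf) (a : R) :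
  describes_real (inverse_program d) a ->
  describes_real (coinverse_program d) (1 - a) ->
  describes_pair (instance_word n d) (1%:M : 'M[R]_n, leaky_channel a).
Proof.
move=> aP caP; exists (fun i j => nat_program (i == j)), (leaky_program d).
split=> // [i j|x y] /=; first by rewrite mxE; exact: describes_nat.
rewrite /leaky_channel /leaky_program; do 3?case: ifP => // _; exact: describes_nat.
Qed.

Lemma leaky_channelP (R : realType) (a : R) :
  y0 != y1 -> 0 <= a <= 1 -> is_channel (leaky_channel a).
Proof.
move=> y01 /andP[a0 a1] x; split=> [y|].
  by rewrite /leaky_channel; do 3?case: ifP; rewrite ?subr_ge0 ?ler0n.
rewrite /leaky_channel; case: (x == x0).
  by rewrite (bigD1 y0) //= eqxx big1 ?addr0 // => y /negPf->.
have y10 : (y1 == y0) = false by rewrite eq_sym (negPf y01).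
rewrite (bigD1 y0) //= eqxx (bigD1 y1) ?y10 //= eqxx.
rewrite big1 => [|y /andP[/negPf-> /negPf-> //]].
by rewrite addr0 addrC subrK.
Qed.

Lemma leaky_capacity_gt0 (R : realType) (x1 : X) (a : R) :
  x0 != x1 -> y0 != y1 -> 0 <= a <= 1 ->
  (0 < zero_error_capacity (leaky_channel a))%E <-> a = 0.
Proof.
move=> x01 y01 a01; split=> [|a0].
  apply: contraPP => /eqP a0; rewrite (@capacity_confusable _ _ _ _ y0) ?ltxx // => x.
  by rewrite /leaky_channel eqxx; case: ifP; rewrite ?oner_eq0.
have Wch := leaky_channelP y01 a01.
apply: lt_le_trans (capacity_separated (x0 := x0) (x1 := x1) Wch _).
  by rewrite lte01.
move=> y; rewrite /leaky_channel eqxx [x1 == x0]eq_sym (negPf x01) a0.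
by case: (y == y0); rewrite ?mulr0 ?mul0r.
Qed.

End Reduction.

Theorem theorem25 (R : realType) (n : nat) (X Y : finType)
    (n_gt0 : (0 < n)%N) (X_gt1 : (1 < #|X|)%N) (Y_gt1 : (1 < #|Y|)%N) :
  ~ semi_decidable (@describes_pair R n X Y)
      (unstable_plants R n `*` computable_channels R X Y)
      (SE_solvable R n X Y).
Proof.
move=> [T TP].
have [x0 [x1 [_ _ x01]]] := card_gt1P X_gt1.
have [y0 [y1 [_ _ y01]]] := card_gt1P Y_gt1.
have [d dP] := self_simulation T (computable_instance_word x0 y0 y1 n).
set w := instance_word x0 y0 y1 n d in dP.
have [a [a01 a_gt0 aP]] := first_stop_limit R (stopped_at T w).
have [daP cdaP] : describes_real (inverse_program d) a /\
    describes_real (coinverse_program d) (1 - a).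
  by apply: describes_coinverse dP _ aP => k; apply/eqP; rewrite -lt0n expn_gt0.
have wP := instance_word_describes x0 y0 y1 n daP cdaP.
have plantP := unstable_identity R n_gt0.
have channelP : computable_channels R X Y (leaky_channel x0 y0 y1 a).
  split=> [|x y]; first exact: leaky_channelP.
  by case: wP => dA [dW [_ dWP _]]; exists (dW x y); exact: dWP.
have capP := leaky_capacity_gt0 x01 y01 a01.
have haltP : tm_halts T w <-> 0 < a.
  by rewrite -a_gt0; split=> -[t tP]; exists t; [apply/eqP|exact/eqP].
have [solved unsolved] :=
  TP (1%:M, leaky_channel x0 y0 y1 a) w (conj plantP channelP) wP.
have solvableP : SE_solvable R n X Y (1%:M, leaky_channel x0 y0 y1 a) <-> a = 0.
  rewrite -capP; split=> [[_ _] /=|cap]; first by rewrite eta_identity.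
  by split=> //=; rewrite eta_identity.
have [a0|/eqP a_neq0] := pselect (a = 0).
  by have /haltP := solved (solvableP.2 a0); rewrite a0 ltxx.
apply: unsolved; first by move/solvableP/eqP; rewrite (negPf a_neq0).
by apply/haltP; rewrite lt0r a_neq0; case/andP: a01.
Qed.
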